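(* Let $w=(b_1^{m_1}\dots b_k^{m_k})\in F\mathbb Z$ with $k\in\mathbb N_0$ and $m_1,\dots,m_k,b_1,\dots,b_k\in\mathbb Z$. For $n\in\mathbb N$ and $j\in\{1,\dots,k\}$ define recursively the integers \[ l_{n,0}:=0,\qquad l_{n,j}:=l_{n,j-1}+(-1)^n\,T_n\bigl(-m_j,\,-b_j,\,-l_{1,j-1},\,l_{2,j-1}-l_{2,k},\,-l_{3,j-1},\,l_{4,j-1}-l_{4,k},\dots\bigr), \] where for $i\in\mathbb N$ the $(i+2)$-nd argument of $T_n$ is $-l_{i,j-1}$ if $i$ is odd and $l_{i,j-1}-l_{i,k}$ if $i$ is even. Then $\ell_n w=l_{n,k}$ for every $n\in\mathbb N$.
   Context: $\mathbb N=\{1,2,3,\dots\}$, $\mathbb N_0=\mathbb N\cup\{0\}$, and $\mathbb Z^{\mathbb N}$ is the set of all maps $a\colon\mathbb N\to\mathbb Z$, written $a=(a(1),a(2),\dots)$. $(F\mathbb Z,\ast)$ denotes the free group on the set $\mathbb Z$; its elements are called words and are written as formal power products $(b_1^{m_1}\dots b_k^{m_k})$ with $k\in\mathbb N_0$, bases $b_i\in\mathbb Z$ (the free generators) and exponents $m_i\in\mathbb Z$ (not necessarily in reduced form). The identity is the empty word $()$, $\ast$ is concatenation with the only rules $(b^m)\ast(b^n)=(b^{m+n})$ and $(b^0)=()$, and $(b)$ abbreviates $(b^1)$. Powers are formal, so $(z^b)$ is the $b$-th power of the generator $z$. Length and content are the group homomorphisms $\#,|\cdot|\colon(F\mathbb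 Z,\ast)\to(\mathbb Z,+)$ with $\#(b_1^{m_1}\dots b_k^{m_k})=m_1+\dots+m_k$ and $|(b_1^{m_1}\dots b_k^{m_k})|=m_1b_1+\dots+m_kb_k$. The reverse of a word $w=(b_1^{m_1}\dots b_k^{m_k})$ is $\overleftarrow{w}:=(b_k^{m_k}\dots b_1^{m_1})$ (a well-defined anti-involution of $F\mathbb Z$). $(\Gamma_z)_{z\in\mathbb Z}$ is the (existing and unique) family of maps $\Gamma_z\colon F\mathbb Z\to F\mathbb Z$ with $\Gamma_z()=()$, $\Gamma_z(b)=(z^b)$ and $\Gamma_z(v\ast w)=\Gamma_zv\ast\Gamma_{z+\#v}w$ for all $z,b\in\mathbb Z$, $v,w\in F\mathbb Z$. For $a\in\mathbb Z^{\mathbb N}$ and $n\in\mathbb N_0$, $\Gamma_a^n\colon F\mathbb Z\to F\mathbb Z$ is defined by $\Gamma_a^0=\mathrm{id}$ and $\Gamma_a^{n}w=\Gamma_{a(n)}(\Gamma_a^{n-1}w)$ for $n\ge1$. Vardi's functionals $T_n\colon\mathbb Z^{\mathbb N}\to\mathbb Z$, $n\in\mathbb N_0$, are defined by $T_na:=|\Gamma_a^n(1)|$, where $(1)$ is the word consisting of the generator $1$; $T_n(a_1,a_2,\dots)$ means $T_na$ for $a=(a_1,a_2,\dots)$. By definition $T_na$ depends only on $a(1),\dots,a(n)$, so in a recursion the later arguments of $T_n$ are irrelevant. The Levine operator is $L\colon F\mathbb Z\to F\mathbb Z$, $L w:=\overleftarrow{\Gamma_1 w}$, with $k$-fold iterate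 $L^k$. For a word $w$ and $n\in\mathbb N$, the $n$-th Levine number of $w$ is $\ell_nw:=\#\,L^{n-1}w$. *)

(* Defs.v *)
From HB Require Import structures.
From mathcomp Require Import all_boot all_order all_algebra.

Set Implicit Arguments.
Unset Strict Implicit.
Unset Printing Implicit Defensive.

Import GRing.Theory.

Local Open Scope ring_scope.

(* The free group on T, as reduced lists of signed letters: (x, true) is the
   generator x and (x, false) is its inverse. *)
Section FreeGroup.
Variable T : choiceType.
Implicit Types (u v : T * bool) (s t : seq (T * bool)).

Definition linv u := (u.1, ~~ u.2).

Definition reduced s := sorted (fun u v => v != linv u) s.

Record freegroup := FreeGroup { fgval :> seq (T * bool); _ : reduced fgval }.

HB.instance Definition _ := [isSub for fgval].
HB.instance Definition _ := [Choice of freegroup by <:].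

Definition lcons u s :=
  if s is v :: s' then if v == linv u then s' else u :: s else [:: u].

Definition lmul s t := foldr lcons t s.

Lemma linvK : involutive linv.
Proof. by case=> x e; rewrite /linv /= negbK. Qed.

Lemma lcons_reduced u s : reduced s -> reduced (lcons u s).
Proof.
case: s => [|v s] //= rs; case: eqP => [_|/eqP uv]; first exact: path_sorted rs.
by rewrite /reduced /= uv.
Qed.

Lemma lcons_path u s : reduced (u :: s) -> lcons u s = u :: s.
Proof. by case: s => [|v s] //= /andP[/negPf->]. Qed.

Lemma lconsK u s : reduced s -> lcons (linv u) (lcons u s) = s.
Proof.
case: s => [|v s] /=; first by rewrite linvK eqxx.
case: eqP => [->|_] rs; first exact: lcons_path.
by rewrite /= linvK eqxx.
Qed.

Lemma lmul_reduced s t : reduced t -> reduced (lmul s t).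
Proof. by move=> rt; elim: s => //= u s; apply: lcons_reduced. Qed.

Lemma lmul_lcons u s t :
  reduced t -> lmul (lcons u s) t = lcons u (lmul s t).
Proof.
case: s => [|v s] //= rt; case: eqP => //= ->.
by have := lconsK (linv u) (lmul_reduced s rt); rewrite linvK /= => ->.
Qed.

Lemma lmulA r s t : reduced t -> lmul r (lmul s t) = lmul (lmul r s) t.
Proof. by move=> rt; elim: r => //= u r IHr; rewrite lmul_lcons // IHr. Qed.

Lemma lmul1 s : reduced s -> lmul s [::] = s.
Proof.
elim: s => //= u s IHs rs; rewrite IHs; first exact: lcons_path.
exact: path_sorted rs.
Qed.

Lemma rev_map_linv_reduced s : reduced s -> reduced (rev (map linv s)).
Proof.
rewrite /reduced rev_sorted sorted_map; apply: sub_sorted => u v /=.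
by rewrite linvK eq_sym.
Qed.

Lemma rev_reduced s : reduced s -> reduced (rev s).
Proof.
rewrite /reduced rev_sorted; apply: sub_sorted => u v /=.
by apply: contraNneq => ->; rewrite linvK.
Qed.

Lemma lmulV s : lmul (rev (map linv s)) s = [::].
Proof.
elim: s => //= u s IHs.
by rewrite rev_cons /lmul foldr_rcons /= linvK eqxx.
Qed.

Lemma fgvalP (w : freegroup) : reduced w. Proof. by case: w. Qed.

Definition fg_one : freegroup := @FreeGroup [::] isT.
Definition fg_mul (v w : freegroup) : freegroup :=
  FreeGroup (lmul_reduced v (fgvalP w)).
Definition fg_inv (w : freegroup) : freegroup :=
  FreeGroup (rev_map_linv_reduced (fgvalP w)).

Lemma fg_mulA : associative fg_mul.
Proof. by move=> u v w; apply/val_inj/lmulA/fgvalP. Qed.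
Lemma fg_mul1w : left_id fg_one fg_mul.
Proof. by move=> w; apply: val_inj. Qed.
Lemma fg_mulw1 : right_id fg_one fg_mul.
Proof. by move=> w; apply/val_inj/lmul1/fgvalP. Qed.
Lemma fg_invK : involutive fg_inv.
Proof.
move=> w; apply: val_inj; rewrite /= map_rev revK -map_comp.
by rewrite (eq_map (g := id)) ?map_id // => u; apply: linvK.
Qed.
Lemma fg_mulVw : left_inverse fg_one fg_inv fg_mul.
Proof. by move=> w; apply/val_inj/lmulV. Qed.
Lemma fg_mulwV : right_inverse fg_one fg_inv fg_mul.
Proof. by move=> w; rewrite -{1}(fg_invK w) fg_mulVw. Qed.

HB.instance Definition _ :=
  isGroup.Build freegroup fg_mulA fg_mul1w fg_mulw1 fg_mulVw fg_mulwV.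

Definition fg_gen (x : T) : freegroup := @FreeGroup [:: (x, true)] isT.

Definition fg_letter u : freegroup := @FreeGroup [:: u] isT.

Lemma fg_letterE u :
  fg_letter u = (if u.2 then fg_gen u.1 else (fg_gen u.1)^-1)%g.
Proof. by case: u => x [] /=; apply: val_inj. Qed.

Lemma fg_ind (P : freegroup -> Prop) :
  P 1%g -> (forall u w, P w -> P (fg_letter u * w)%g) -> forall w, P w.
Proof.
move=> P1 PM [s rs]; elim: s rs => [|u s IHs] rs.
  by rewrite (_ : FreeGroup rs = 1%g) //; apply: val_inj.
have rs' : reduced s by exact: path_sorted rs.
rewrite (_ : FreeGroup rs = fg_letter u * FreeGroup rs')%g; first exact/PM/IHs.
by apply: val_inj; rewrite /= lcons_path.
Qed.

Definition fg_rev (w : freegroup) : freegroup :=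
  FreeGroup (rev_reduced (fgvalP w)).

Lemma lmul_cat s t : reduced (s ++ t) -> lmul s t = s ++ t.
Proof.
elim: s => //= u s IHs rst; rewrite IHs; first exact: lcons_path.
exact: path_sorted rst.
Qed.

Lemma fg_revM (v w : freegroup) : fg_rev (v * w)%g = (fg_rev w * fg_rev v)%g.
Proof.
have revM u (x : freegroup) :
    fg_rev (fg_letter u * x)%g = (fg_rev x * fg_letter u)%g.
  apply: val_inj; case: x => -[|y s] //= rs.
  case: eqP rs => [->|/eqP yu] rs.
    rewrite rev_cons /lmul foldr_rcons /= linvK eqxx -/(lmul _ _) lmul1 //.
    exact/rev_reduced/(path_sorted rs).
  rewrite [in LHS]rev_cons -cats1 lmul_cat // cats1 -rev_cons.
  by apply: rev_reduced; rewrite /reduced /= yu.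
elim/fg_ind: v => [|u v IHv].
  rewrite mul1g (_ : fg_rev 1 = 1)%g ?mulg1 //; exact: val_inj.
by rewrite -mulgA (revM u (v * w)%g) IHv (revM u v) mulgA.
Qed.

End FreeGroup.

Definition expgz (G : groupType) (x : G) (m : int) : G :=
  (match m with Posz n => x ^+ n | Negz n => x ^- n.+1 end)%g.

Section Words.
Implicit Types (u : int * bool) (v w : freegroup int) (z : int).

Definition lsign u : int := if u.2 then 1 else -1.

Definition wlength w : int := \sum_(u <- fgval w) lsign u.

Definition wcontent w : int := \sum_(u <- fgval w) lsign u * u.1.

(* The value on the inverse of a generator b is forced by the cocycle rule:
   1 = Gamma z (b^-1 * b) = Gamma z (b^-1) * Gamma (z - 1) b. *)
Fixpoint Gamma_seq z (s : seq (int * bool)) : freegroup int :=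
  (match s with
   | [::] => 1
   | (b, true) :: s' => expgz (fg_gen z) b * Gamma_seq (z + 1)%R s'
   | (b, false) :: s' =>
       expgz (fg_gen (z - 1)%R) (- b)%R * Gamma_seq (z - 1)%R s'
   end)%g.

Definition Gamma z w : freegroup int := Gamma_seq z (fgval w).

(* Sequences indexed from 1 are encoded by functions on nat shifted by one:
   a i stands for the term a(i+1). *)
Fixpoint Gamma_iter (a : nat -> int) (n : nat) w : freegroup int :=
  if n is n'.+1 then Gamma (a n') (Gamma_iter a n' w) else w.

Definition vardi (n : nat) (a : nat -> int) : int :=
  wcontent (Gamma_iter a n (fg_gen 1)).

Definition levine w : freegroup int := fg_rev (Gamma 1 w).

Definition levine_number (n : nat) w : int := wlength (iter n.-1 levine w).

End Words.

(* The argument (-m, -b, -p 1, p 2 - q 2, -p 3, p 4 - q 4, ...) of T_n, in the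
   shifted encoding of sequences. *)
Definition vardi_arg (m b : int) (p q : nat -> int) (i : nat) : int :=
  match i with
  | 0 => - m
  | 1 => - b
  | i'.+2 => if odd i'.+1 then - p i'.+1 else p i'.+1 - q i'.+1
  end.

Section Facts.
Implicit Types (u : int * bool) (v w : freegroup int) (z b : int).

Lemma expgzN (G : groupType) (x : G) m : expgz x (- m) = (expgz x m)^-1%g.
Proof.
case: m => [[|n]|n]; rewrite ?oppr0 /= ?invg1 //.
by rewrite /= invgK.
Qed.

Lemma wlengthM v w : wlength (v * w)%g = wlength v + wlength w.
Proof.
rewrite /wlength /= /lmul; elim: (fgval v) => [|u s IHs].
  by rewrite big_nil add0r.
rewrite big_cons -addrA -{}IHs /=.
case: (foldr _ _ _) => [|x t] /=; first by rewrite big_seq1 big_nil addr0.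
case: eqP => [->|_]; rewrite !big_cons // addrA.
by case: u => c []; rewrite /lsign /= ?subrr ?addNr add0r.
Qed.

Lemma wlength_gen b : wlength (fg_gen b) = 1.
Proof. by rewrite /wlength big_seq1. Qed.

Lemma wcontentM v w : wcontent (v * w)%g = wcontent v + wcontent w.
Proof.
rewrite /wcontent /= /lmul; elim: (fgval v) => [|u s IHs].
  by rewrite big_nil add0r.
rewrite big_cons -addrA -{}IHs /=.
case: (foldr _ _ _) => [|x t] /=; first by rewrite big_seq1 big_nil addr0.
case: eqP => [->|_]; rewrite !big_cons // addrA.
by case: u => c []; rewrite /lsign /= mulN1r mul1r ?subrr ?addNr add0r.
Qed.

Lemma wcontent_gen b : wcontent (fg_gen b) = b.
Proof. by rewrite /wcontent big_seq1 /lsign mul1r. Qed.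

Lemma fg_rev_gen (T : choiceType) (x : T) : fg_rev (fg_gen x) = fg_gen x.
Proof. exact: val_inj. Qed.

Lemma fg_revK (T : choiceType) : involutive (@fg_rev T).
Proof. by move=> w; apply: val_inj; rewrite /= revK. Qed.

Lemma Gamma1 z : Gamma z 1%g = 1%g.
Proof. by []. Qed.

Lemma Gamma_gen z b : Gamma z (fg_gen b) = expgz (fg_gen z) b.
Proof. exact: mulg1. Qed.

Lemma GammaM z v w :
  Gamma z (v * w)%g = (Gamma z v * Gamma (z + wlength v)%R w)%g.
Proof.
have GC z' u s : Gamma_seq z' (lcons u s)
    = (Gamma_seq z' [:: u] * Gamma_seq (z' + lsign u)%R s)%g.
  case: u s => c e [|x t]; first by case: e; rewrite /= !mulg1.
  rewrite /lcons; case: eqP => [->|_]; last by case: e; rewrite /lsign /= mulg1.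
  by case: e; rewrite /linv /lsign /= mulg1 expgzN ?addrK ?subrK mulgA
    ?mulgV ?mulVg mul1g.
rewrite /Gamma /wlength /= /lmul.
elim: (fgval v) z => [|u s IHs] z; first by rewrite big_nil addr0 mul1g.
rewrite /= GC IHs big_cons addrA mulgA; congr (_ * _)%g.
by case: u => c []; rewrite /lsign /= mulg1.
Qed.

Lemma Gamma_unique (G : int -> freegroup int -> freegroup int) :
    (forall z, G z 1%g = 1%g) ->
    (forall z b, G z (fg_gen b) = expgz (fg_gen z) b) ->
    (forall z v w, G z (v * w)%g = (G z v * G (z + wlength v)%R w)%g) ->
  forall z w, G z w = Gamma z w.
Proof.
move=> G1 Gg GM z w; elim/fg_ind: w z => [|u w IHw] z; first by rewrite G1.
rewrite GM GammaM IHw; congr (_ * _)%g; rewrite fg_letterE.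
case: u => c [] /=; first by rewrite Gg Gamma_gen.
have V (F : int -> freegroup int -> freegroup int) :
    (forall z, F z 1%g = 1%g) ->
    (forall z v w, F z (v * w)%g = (F z v * F (z + wlength v)%R w)%g) ->
    F z (fg_gen c)^-1%g = (F (z - 1)%R (fg_gen c))^-1%g.
  move=> F1 FM; apply/eqP; rewrite -mulg_eq1.
  have <- : wlength (fg_gen c)^-1%g = -1 by rewrite /wlength big_seq1.
  by rewrite -FM mulVg F1.
by rewrite (V G) // (V Gamma) ?Gg ?Gamma_gen //; apply: GammaM.
Qed.

Lemma eq_vardi n (a a' : nat -> int) :
  (forall i, (i < n)%N -> a i = a' i) -> vardi n a = vardi n a'.
Proof.
rewrite /vardi => aa'; congr wcontent.
elim: n aa' => //= n IHn aa'; rewrite aa' // IHn // => i /ltnW; exact: aa'.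
Qed.

(* The recursion for the integers l_{n,j} is solvable: the n-th row only
   involves earlier rows. *)
Lemma levine_recursion_exists (k : nat) (m b : 'I_k -> int) :
  exists l : nat -> nat -> int,
    (forall n, (0 < n)%N -> l n 0 = 0) /\
    (forall n (j : 'I_k), (0 < n)%N ->
       l n j.+1 = l n j + (-1) ^+ n *
         vardi n (vardi_arg (m j) (b j) (l^~ j) (l^~ k))).
Proof.
pose step (l : nat -> nat -> int) n := fix row j : int :=
  if j is j'.+1 then row j' + (if insub j' is Some i then (-1) ^+ n *
    vardi n (vardi_arg (m i) (b i) (l^~ j') (l^~ k)) else 0) else 0.
pose fix tab N : nat -> nat -> int :=
  if N is N'.+1 then
    fun n => if n == N' then step (tab N') n else tab N' n
  else fun _ _ => 0.
have tabS N n : tab N.+1 n = if n == N then step (tab N) n else tab N n by [].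
have tabE N n : (n < N)%N -> tab N n = tab n.+1 n.
  elim: N => // N IHN; rewrite ltnS leq_eqVlt => /predU1P[->//|ltnN].
  by rewrite tabS ltn_eqF // IHN.
exists (fun n => tab n.+1 n); split=> [n _|n j _]; first by rewrite tabS eqxx.
rewrite !tabS eqxx /= valK; congr (_ + _ * _).
apply: eq_vardi => -[|[|i]] ltin //=.
have e : tab n i.+1 = tab i.+2 i.+1 by apply: tabE; apply: ltnW.
by rewrite e tabS eqxx.
Qed.

End Facts.

(* Main.v *)
Require Import Defs.
From HB Require Import structures.
From mathcomp Require Import all_boot all_order all_algebra.

(** The mechanism is a twist that turns the Levine operator into [Gamma].
    Let [fg_twist] be the automorphism of the free group sending a generator
    b to the inverse of the generator - b.  The reversal in
    L w = rev (Gamma 1 w) is an anti-automorphism, so it becomes an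
    automorphism after composition with inversion, and comparing the two
    cocycles on generators gives ([Gamma_twist])
      Gamma 0 (fg_twist w) = (fg_twist (L w))^-1.
    Hence, with w_n = L^(n-1) w, the words Z_n := fg_twist w_n for n odd and
    Z_n := (fg_twist w_n)^-1 for n even satisfy a recursion in which no reversal
    is left.  For n odd, Z_(n+1) = Gamma 0 Z_n; for n even,
    Z_(n+1) = (Gamma 0 Z_n^-1)^-1, which is Gamma (- wlength Z_n) Z_n because
    the cocycle rule applied to Z_n^-1 * Z_n gives 1 ([GammaV]).

    By the cocycle rule ([Gamma_prod]), Gamma z acts on a product of blocks by
    acting on each block separately, the base point z being shifted by the
    length of the blocks to its left.  So Z_n stays a product of k blocks; the
    j-th one starts as (- b_j)^(- m_j), which is
    Gamma (- b_j) (Gamma (- m_j) (1)), and at each step receives the Gamma whose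
    base point is the next entry of the argument sequence of Vardi's
    functionals.  Since wlength (Gamma z v) = wcontent v, the length of the
    j-th block of Z_n is the value of T_n at that sequence.  Finally
    wlength Z_n = (-1)^n wlength w_n, and summing over the blocks identifies
    the lengths of the prefixes of Z_n with the l_(n,j) up to that sign. *)

Set Implicit Arguments.
Unset Strict Implicit.
Unset Printing Implicit Defensive.

Import GRing.Theory.

Local Open Scope ring_scope.

Lemma expgzV (G : groupType) (x : G) m : expgz x^-1%g m = expgz x (- m).
Proof.
by rewrite expgzN; case: m => n /=; rewrite expVgn ?invgK.
Qed.

Lemma expgz_morph (G H : groupType) (f : G -> H) :
    f 1%g = 1%g -> {morph f : x y / (x * y)%g} ->
  forall x m, f (expgz x m) = expgz (f x) m.
Proof.
move=> f1 fM x.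
have fX n : f (x ^+ n)%g = (f x ^+ n)%g.
  by elim: n => [|n IHn]; rewrite ?expg0 // !expgS fM IHn.
case=> n /=; first exact: fX.
by apply: (mulgI (f x ^+ n.+1)%g); rewrite mulgV -fX -fM mulgV.
Qed.

Lemma wlength1 : wlength 1%g = 0.
Proof. exact: big_nil. Qed.

Lemma wlengthV w : wlength w^-1%g = - wlength w.
Proof. by apply/eqP; rewrite -addr_eq0 -wlengthM mulVg wlength1. Qed.

Lemma wlength_expgz x m : wlength (expgz x m) = wlength x * m.
Proof.
have lX n : wlength (x ^+ n)%g = wlength x * n%:Z.
  elim: n => [|n IHn]; first by rewrite expg0 wlength1 mulr0.
  by rewrite expgS wlengthM IHn intS mulrDr mulr1.
case: m => n /=; first exact: lX.
by rewrite wlengthV lX NegzE mulrN.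
Qed.

(** [Gamma z v] and [Gamma (z + wlength v) v^-1] cancel by the cocycle rule. *)
Lemma GammaV z v : Gamma z v^-1%g = (Gamma (z - wlength v) v)^-1%g.
Proof.
by apply: (mulIg (Gamma (z - wlength v) v)); rewrite mulVg -wlengthV -GammaM
  mulVg.
Qed.

(** The base point affects only which generators occur in [Gamma z w], not
    their exponents: a generator b contributes z'^b, of length b, whatever the
    base point z' met there.  So the cocycle rule reduces to additivity. *)
Lemma wlength_Gamma z w : wlength (Gamma z w) = wcontent w.
Proof.
have gen y c : wlength (Gamma y (fg_gen c)) = c.
  by rewrite Gamma_gen wlength_expgz wlength_gen mul1r.
elim/fg_ind: w z => [|u w IHw] z; first by rewrite wlength1 /wcontent big_nil.
rewrite GammaM wlengthM IHw wcontentM fg_letterE; congr (_ + _).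
case: u => c [] /=; first by rewrite gen wcontent_gen.
rewrite GammaV wlengthV gen; apply/eqP.
by rewrite eq_sym -addr_eq0 -{2}(wcontent_gen c) -wcontentM mulVg
  /wcontent big_nil.
Qed.

Lemma wlength_Gamma_iter a n :
  wlength (Gamma_iter a n.+1 (fg_gen 1)) = vardi n a.
Proof. exact: wlength_Gamma. Qed.

(** The cocycle rule for a product of several blocks, where [S j] is the
    length of the product of the first [j] blocks. *)
Lemma Gamma_prod k (v : 'I_k -> freegroup int) (S : nat -> int) z :
    S 0 = 0 -> (forall j : 'I_k, S j.+1 = S j + wlength (v j)) ->
  wlength (\prod_(j < k) v j)%g = S k /\
  Gamma z (\prod_(j < k) v j)%g = (\prod_(j < k) Gamma (z + S j) (v j))%g.
Proof.
move=> S0; elim: k v => [|k IHk] v vS; first by rewrite !big_ord0 wlength1.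
have [j|lenE GE] := IHk (fun j => v (widen_ord (leqnSn k) j)).
  exact: (vS (widen_ord (leqnSn k) j)).
by rewrite !big_ord_recr /= wlengthM GammaM lenE GE (vS ord_max).
Qed.

Definition letter_twist (u : int * bool) : int * bool := (- u.1, ~~ u.2).

Lemma letter_twistK : involutive letter_twist.
Proof. by case=> b e; rewrite /letter_twist /= opprK negbK. Qed.

Lemma letter_twist_linv u : letter_twist (linv u) = linv (letter_twist u).
Proof. by []. Qed.

Lemma twist_reduced (s : seq (int * bool)) :
  reduced s -> reduced (map letter_twist s).
Proof.
rewrite /reduced sorted_map; apply: sub_sorted => u v /=.
by rewrite -letter_twist_linv (can_eq letter_twistK).
Qed.

(** The automorphism sending each generator b to the inverse of - b. *)
Definition fg_twist (w : freegroup int) : freegroup int :=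
  FreeGroup (twist_reduced (fgvalP w)).

Lemma fg_twist1 : fg_twist 1%g = 1%g.
Proof. exact: val_inj. Qed.

Lemma fg_twistK : involutive fg_twist.
Proof. by move=> w; apply: val_inj; rewrite /= (mapK letter_twistK). Qed.

(** Reduction of words commutes with any relabelling of the letters that is
    injective and compatible with inversion of letters. *)
Lemma fg_twistM : {morph fg_twist : v w / (v * w)%g}.
Proof.
have lconsE u s : map letter_twist (lcons u s)
    = lcons (letter_twist u) (map letter_twist s).
  case: s => //= v s.
  by rewrite -letter_twist_linv (can_eq letter_twistK); case: ifP.
move=> v w; apply: val_inj; rewrite /= /lmul.
by elim: (fgval v) => //= u s IHs; rewrite lconsE IHs.
Qed.

Lemma fg_twist_gen b : fg_twist (fg_gen b) = (fg_gen (- b))^-1%g.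
Proof. exact: val_inj. Qed.

Lemma fg_twist_expgz b m :
  fg_twist (expgz (fg_gen b) m) = expgz (fg_gen (- b)) (- m).
Proof.
by rewrite (expgz_morph fg_twist1 fg_twistM) fg_twist_gen expgzV.
Qed.

Lemma fg_rev_expgz (b m : int) :
  fg_rev (expgz (fg_gen b) m) = expgz (fg_gen b) m.
Proof.
(* Reversal reverses products, so its composite with inversion is a morphism. *)
pose f (w : freegroup int) := (fg_rev w)^-1%g.
have f1 : f 1%g = 1%g by exact: val_inj.
have fM : {morph f : v w / (v * w)%g} by move=> v w; rewrite /f fg_revM invgM.
apply: invg_inj; rewrite -/(f _) (expgz_morph f1 fM) /f fg_rev_gen.
by rewrite expgzV expgzN.
Qed.

Lemma wlength_twist w : wlength (fg_twist w) = - wlength w.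
Proof.
rewrite /wlength /= big_map -sumrN; apply: eq_bigr => -[b e] _.
by case: e; rewrite /lsign /= ?opprK.
Qed.

(** Conjugated by the twist and freed of its reversal, [Gamma (1 - z)] obeys the
    rules characterizing [Gamma z]: the twist negates lengths, so that the base
    point 1 - z - wlength v met after a prefix v is 1 - (z + wlength v), and a
    generator b is sent to the (- z)-th generator to the power b, which the
    outer twist and inversion turn into the z-th generator to the power b. *)
Lemma Gamma_twist w : Gamma 0 (fg_twist w) = (fg_twist (levine w))^-1%g.
Proof.
pose G z v := (fg_twist (fg_rev (Gamma (1 - z) (fg_twist v))))^-1%g.
have GE : forall z v, G z v = Gamma z v.
  apply: Gamma_unique => [z|z b|z u v]; rewrite /G.
  - by apply: val_inj.
  - rewrite fg_twist_gen GammaV wlength_gen Gamma_gen -expgzN opprK.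
    by rewrite fg_rev_expgz fg_twist_expgz -expgzN opprK addrAC subrr add0r opprK.
  rewrite fg_twistM GammaM fg_revM fg_twistM invgM wlength_twist.
  by rewrite opprD addrA.
by rewrite -GE /G fg_twistK subr0.
Qed.

Theorem theorem3p15 (k : nat) (m b : 'I_k -> int) (l : nat -> nat -> int)
    (l0 : forall n : nat, (0 < n)%N -> l n 0%N = 0)
    (lS : forall (n : nat) (j : 'I_k), (0 < n)%N ->
       l n j.+1 = l n j + (-1) ^+ n *
         vardi n (vardi_arg (m j) (b j)
                   (fun i : nat => l i j) (fun i : nat => l i k))) :
  forall n : nat, (0 < n)%N ->
    levine_number n (\prod_(j < k) expgz (fg_gen (b j)) (m j))%g = l n k.
Proof.
set w := (\prod_(j < k) _)%g => -[//|n _]; rewrite /levine_number /=.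
(* Y i j is the j-th block of the word Z_(i+1) and S i j the length of the first
   j blocks.  The blocks of Z_1 already consume two entries of the
   argument sequence, - m_j and - b_j, whence the i + 2 iterations. *)
pose arg (j : 'I_k) := vardi_arg (m j) (b j) (l^~ j) (l^~ k).
pose Y i (j : 'I_k) := Gamma_iter (arg j) i.+2 (fg_gen 1).
pose Z i := (\prod_(j < k) Y i j)%g.
pose S i j : int := (-1) ^+ i.+1 * l i.+1 j.
have S0 i : S i 0 = 0 by rewrite /S l0 ?mulr0.
have SS i (j : 'I_k) : S i j.+1 = S i j + wlength (Y i j).
  by rewrite wlength_Gamma_iter /S lS // mulrDr mulrA -expr2 sqrr_sign mul1r.
have lenZ i : wlength (Z i) = S i k by case: (Gamma_prod 0 (S0 i) (SS i)).
have GZ i z : Gamma z (Z i) = (\prod_(j < k) Gamma (z + S i j) (Y i j))%g.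
  by case: (Gamma_prod z (S0 i) (SS i)).
have ZS i : Z i.+1 = Gamma (if odd i then - wlength (Z i) else 0) (Z i).
  rewrite GZ; apply: eq_bigr => j _; rewrite {1}/Y /= -/(Y i j); congr Gamma.
  (* For n := i + 1 odd the length of the preceding blocks is - l n j and the
     base point is 0; for n even that length is l n j, shifted by - l n k. *)
  rewrite lenZ /S -signr_odd /=; case: (odd i) => /=.
    by rewrite !mul1r addrC.
  by rewrite add0r mulN1r.
have Z0 : Z 0 = fg_twist w.
  rewrite (big_morph _ fg_twistM fg_twist1); apply: eq_bigr => j _.
  by rewrite fg_twist_expgz /Y /= Gamma_gen /= Gamma_gen.
have ZE i : Z i = (let v := fg_twist (iter i levine w) in
                   if odd i then v^-1 else v)%g.
  elim: i => //= i IHi; rewrite ZS; case: (odd i) IHi => /= IHi.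
    by rewrite -{2}[Z i]invgK GammaV wlengthV opprK addNr IHi invgK Gamma_twist
      invgK.
  by rewrite IHi Gamma_twist.
have: wlength (Z n) = (-1) ^+ n.+1 * wlength (iter n levine w).
  rewrite ZE -signr_odd /=; case: (odd n) => /=.
    by rewrite wlengthV wlength_twist opprK mul1r.
  by rewrite wlength_twist mulN1r.
by rewrite lenZ => /(can_inj (signrMK _)).
Qed.
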